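(* Let $M\in\mathbb{R}^{m\times n}$ with $M\neq 0$ and let $\gamma>0$. Consider the two problems $$\text{(P)}\quad \min_{X,Y\in\mathbb{R}^{m\times n}}\{\|X\|_*+\gamma\|Y\|_1 \ :\ X+Y=M\},\qquad \text{(D)}\quad \min_{Z\in\mathbb{R}^{m\times n}}\{\max\{\|Z\|_2,\|Z\|_\infty/\gamma\}\ :\ \langle M,Z\rangle\geq 1\},$$ and assume that neither $(X,Y)=(M,0)$ nor $(X,Y)=(0,M)$ is an optimal solution of (P). Let $Z$ be an arbitrary optimal solution of (D), let $r\in\{1,2,\ldots,\min(m,n)\}$ be the multiplicity of $\|Z\|_2$ as a singular value of $Z$, and let $U\in\mathbb{R}^{m\times r}$ and $V\in\mathbb{R}^{n\times r}$ be formed by the leading left and right singular vectors of $Z$. Then, for $X\in\mathbb{R}^{m\times n}$, the pair $(X,Y)=(X,M-X)$ is an optimal solution of (P) with neither $X$ nor $M-X$ zero if and only if $$X=UTV^\top\ \text{ for some } T\succeq 0\quad\text{and}\quad \frac{Z}{\gamma\|Z\|_2}\in\partial\|M-X\|_1 .$$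
   Context: For real $m\times n$ matrices: $\langle A,B\rangle=\operatorname{tr}(A^\top B)$; $\|X\|_*$ is the nuclear norm (sum of the singular values); $\|Y\|_1=\sum_{i,j}|Y_{ij}|$; $\|Z\|_2$ is the spectral norm (largest singular value); $\|Z\|_\infty=\max_{i,j}|Z_{ij}|$. The leading singular vectors are taken from one singular value decomposition of $Z$: the columns $u_1,\dots,u_r$ of $U$ and $v_1,\dots,v_r$ of $V$ are orthonormal and paired, so that $Zv_i=\|Z\|_2u_i$ and $Z^\top u_i=\|Z\|_2v_i$. $T\succeq 0$ means that $T\in\mathbb{R}^{r\times r}$ is symmetric and positive semidefinite. $\partial\|W\|_1$ denotes the convex subdifferential of the norm $\|\cdot\|_1$ at the matrix $W$. *)

(* Defs.v *)
From mathcomp Require Import all_boot all_order all_algebra.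
From mathcomp Require Import all_classical all_reals all_analysis.

Set Implicit Arguments.
Unset Strict Implicit.
Unset Printing Implicit Defensive.

Import Order.TTheory GRing.Theory Num.Theory.

Local Open Scope classical_set_scope.
Local Open Scope ring_scope.

Definition mxdot (R : realType) (m n : nat) (A B : 'M[R]_(m, n)) : R :=
  \tr (A^T *m B).

(* The singular values of A are the nonnegative square roots of the eigenvalues
   of A^T A. *)
Definition singular_values (R : realType) (m n : nat) (A : 'M[R]_(m, n)) :
    set R :=
  [set s | 0 <= s /\ eigenvalue (A^T *m A) (s ^+ 2)].

(* For s > 0 this is the number of occurrences of s on the diagonal of a singular
   value decomposition of A.  For s = 0 it is n - \rank A, which exceeds that
   number when m < n. *)
Definition singular_mult (R : realType) (m n : nat) (A : 'M[R]_(m, n)) (s : R) :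
    nat :=
  \rank (eigenspace (A^T *m A) (s ^+ 2)).

(* A finitely supported sum: a matrix has finitely many eigenvalues. *)
Definition nuclear_norm (R : realType) (m n : nat) (A : 'M[R]_(m, n)) : R :=
  \sum_(s \in singular_values A) s *+ singular_mult A s.

(* The set is finite, so its supremum is the largest singular value; without any
   column the set is empty and the supremum is 0 by convention. *)
Definition spectral_norm (R : realType) (m n : nat) (A : 'M[R]_(m, n)) : R :=
  sup (singular_values A).

Definition mx_norm1 (R : realType) (m n : nat) (A : 'M[R]_(m, n)) : R :=
  \sum_i \sum_j `|A i j|.

(* Reduced form, with the min(m, n) singular values in nonincreasing order. *)
Definition is_svd (R : realType) (m n : nat) (A : 'M[R]_(m, n))
    (P : 'M[R]_(m, minn m n)) (s : 'rV[R]_(minn m n))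
    (Q : 'M[R]_(n, minn m n)) : Prop :=
  [/\ P^T *m P = 1%:M, Q^T *m Q = 1%:M,
      (forall i, 0 <= s 0 i),
      (forall i j : 'I_(minn m n), (i <= j)%N -> s 0 j <= s 0 i)
    & A = P *m diag_mx s *m Q^T].

Definition leading_singular_vectors (R : realType) (m n r : nat)
    (A : 'M[R]_(m, n)) (U : 'M[R]_(m, r)) (V : 'M[R]_(n, r)) : Prop :=
  exists P s Q, is_svd A P s Q /\
    exists le_r : (r <= minn m n)%N,
      U = colsub (widen_ord le_r) P /\ V = colsub (widen_ord le_r) Q.

Definition psdmx (R : realType) (r : nat) (T : 'M[R]_r) : Prop :=
  T^T = T /\ forall x : 'cV[R]_r, 0 <= (x^T *m T *m x) 0 0.

Definition subdifferential (R : realType) (m n : nat) (f : 'M[R]_(m, n) -> R)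
    (W : 'M[R]_(m, n)) : set 'M[R]_(m, n) :=
  [set G | forall W', f W + mxdot G (W' - W) <= f W'].

Definition argmin (R : realType) (T : Type) (C : set T) (f : T -> R) : set T :=
  [set x | C x /\ forall y, C y -> f x <= f y].

Definition optimal_P (R : realType) (m n : nat) (M : 'M[R]_(m, n)) (gamma : R) :
    set ('M[R]_(m, n) * 'M[R]_(m, n)) :=
  argmin [set XY | XY.1 + XY.2 = M]
         (fun XY => nuclear_norm XY.1 + gamma * mx_norm1 XY.2).

(* mx_norm is the entrywise maximum norm. *)
Definition optimal_D (R : realType) (m n : nat) (M : 'M[R]_(m, n)) (gamma : R) :
    set 'M[R]_(m, n) :=
  argmin [set Z | 1 <= mxdot M Z]
         (fun Z => Num.max (spectral_norm Z) (mx_norm Z / gamma)).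

(* Main.v *)
Require Import Defs.
From mathcomp Require Import all_boot all_order all_algebra.
From mathcomp Require Import all_classical all_reals all_analysis.
From mathcomp Require Import ring lra.

Set Implicit Arguments.
Unset Strict Implicit.
Unset Printing Implicit Defensive.

Import Order.TTheory GRing.Theory Num.Theory.
Import numFieldNormedType.Exports.

Local Open Scope classical_set_scope.
Local Open Scope ring_scope.

(* For dual feasible Z with s = ||Z||_2 and any splitting M = X + Y,
   1 <= <M,Z> = <X,Z> + <Y,Z> <= s ||X||_* + ||Z||_oo ||Y||_1.
   A Hahn-Banach functional supporting (P) at an optimal pair shows that the
   optimal values of (P) and (D) are inverse to each other, so for optimal pairs
   with X <> 0 every inequality is tight: s is the value of (D),
   <X,Z> = s ||X||_* and <Y,Z> = gamma s ||Y||_1.  The last equality is the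
   subdifferential condition.  Diagonalizing X^T X = Q diag(d) Q^T, the equality
   <X,Z> = s ||X||_* splits into X q_i = (sqrt d_i / s) Z q_i together with
   Z^T Z q_i = s^2 q_i whenever d_i <> 0; hence q_i lies in the column space of V
   and X = U T V^T with T = V^T (X^T X)^(1/2) V.  Conversely, ||U T V^T||_* = tr T,
   so the two conditions make the chain of inequalities tight. *)

(** * The trace inner product and positive semidefinite forms *)

Section FrobeniusInnerProduct.
Variable R : realType.

Lemma mxdotE m n (A B : 'M[R]_(m, n)) : mxdot A B = \sum_j \sum_i A i j * B i j.
Proof.
rewrite /mxdot /mxtrace; apply: eq_bigr => j _; rewrite mxE.
by apply: eq_bigr => i _; rewrite mxE.
Qed.

Lemma mxdotC m n (A B : 'M[R]_(m, n)) : mxdot A B = mxdot B A.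
Proof. by rewrite /mxdot -mxtrace_tr trmx_mul trmxK. Qed.

Lemma mxdotDr m n (A B C : 'M[R]_(m, n)) : mxdot A (B + C) = mxdot A B + mxdot A C.
Proof. by rewrite /mxdot mulmxDr mxtraceD. Qed.

Lemma mxdotZr m n a (A B : 'M[R]_(m, n)) : mxdot A (a *: B) = a * mxdot A B.
Proof. by rewrite /mxdot -scalemxAr mxtraceZ. Qed.

Lemma mxdotDl m n (A B C : 'M[R]_(m, n)) : mxdot (A + B) C = mxdot A C + mxdot B C.
Proof. by rewrite mxdotC mxdotDr !(mxdotC C). Qed.

Lemma mxdotZl m n a (A B : 'M[R]_(m, n)) : mxdot (a *: A) B = a * mxdot A B.
Proof. by rewrite mxdotC mxdotZr mxdotC. Qed.

Lemma mxdotNr m n (A B : 'M[R]_(m, n)) : mxdot A (- B) = - mxdot A B.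
Proof. by rewrite -scaleN1r mxdotZr mulN1r. Qed.

Lemma mxdotNl m n (A B : 'M[R]_(m, n)) : mxdot (- A) B = - mxdot A B.
Proof. by rewrite mxdotC mxdotNr mxdotC. Qed.

Lemma mxdot0r m n (A : 'M[R]_(m, n)) : mxdot A 0 = 0.
Proof. by rewrite -[0](scale0r (0 : 'M[R]_(m, n))) mxdotZr mul0r. Qed.

Lemma mxdot_mulAl m n p (A : 'M[R]_(m, n)) (B : 'M[R]_(n, p)) (C : 'M[R]_(m, p)) :
  mxdot (A *m B) C = mxdot B (A^T *m C).
Proof. by rewrite /mxdot trmx_mul mulmxA. Qed.

Lemma mxdot_mulAr m n p (A : 'M[R]_(m, n)) (B : 'M[R]_(n, p)) (C : 'M[R]_(m, p)) :
  mxdot (A *m B) C = mxdot A (C *m B^T).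
Proof. by rewrite /mxdot trmx_mul -mulmxA mxtrace_mulC mulmxA. Qed.

Lemma mxdot_ge0 m n (A : 'M[R]_(m, n)) : 0 <= mxdot A A.
Proof.
rewrite mxdotE; apply: sumr_ge0 => j _; apply: sumr_ge0 => i _.
by rewrite -expr2 sqr_ge0.
Qed.

Lemma mxdot_eq0 m n (A : 'M[R]_(m, n)) : mxdot A A = 0 -> A = 0.
Proof.
rewrite mxdotE => /eqP; rewrite psumr_eq0 => [/allP A0|j _]; last first.
  by apply: sumr_ge0 => i _; rewrite -expr2 sqr_ge0.
apply/matrixP => i j; rewrite mxE.
have := A0 j (mem_index_enum _); rewrite psumr_eq0 => [/allP Aj0|k _]; last first.
  by rewrite -expr2 sqr_ge0.
by have := Aj0 i (mem_index_enum _); rewrite -expr2 sqrf_eq0 => /eqP.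
Qed.

Lemma mxdot_gt0 m n (A : 'M[R]_(m, n)) : A != 0 -> 0 < mxdot A A.
Proof.
move=> A0; rewrite lt_neqAle mxdot_ge0 andbT eq_sym.
by apply: contra A0 => /eqP/mxdot_eq0/eqP.
Qed.

Lemma mxdot_sqr_le m n (A B : 'M[R]_(m, n)) :
  mxdot A B ^+ 2 <= mxdot A A * mxdot B B.
Proof.
have [->|B0] := eqVneq B 0; first by rewrite !mxdot0r expr0n mulr0.
have := mxdot_gt0 B0; set b := mxdot B B => b_gt0.
(* This is [b] times the component of [A] orthogonal to [B]; its squared norm is [b] times the gap
   in the Cauchy-Schwarz inequality. *)
have := mxdot_ge0 (b *: A - mxdot A B *: B).
rewrite !(mxdotDl, mxdotDr, mxdotNl, mxdotNr, mxdotZl, mxdotZr) (mxdotC B A).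
rewrite -/b => h.
have : 0 <= b * (mxdot A A * b - mxdot A B ^+ 2) by lra.
by rewrite pmulr_rge0 // subr_ge0.
Qed.

Lemma mxdot_col m n (A B : 'M[R]_(m, n)) :
  mxdot A B = \sum_j mxdot (col j A) (col j B).
Proof.
rewrite mxdotE; apply: eq_bigr => j _; rewrite mxdotE big_ord1.
by apply: eq_bigr => i _; rewrite !mxE.
Qed.

(* Testing positivity at x - t N x for small t > 0 forces N x = 0. *)
Lemma psd_kernel n (N : 'M[R]_n) (x : 'cV[R]_n) : N^T = N ->
  (forall y : 'cV[R]_n, 0 <= mxdot y (N *m y)) ->
  mxdot x (N *m x) = 0 -> N *m x = 0.
Proof.
move=> Nsym N_ge0 Nx0; apply: mxdot_eq0.
set z := N *m x; set a := mxdot z z; set c := mxdot z (N *m z).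
have a_ge0 : 0 <= a by exact: mxdot_ge0.
have c_ge0 : 0 <= c by exact: N_ge0.
have xNz : mxdot x (N *m z) = a by rewrite -{1}Nsym -mxdot_mulAl.
have key t : 0 <= t ^+ 2 * c - t * a *+ 2.
  have := N_ge0 (x - t *: z).
  rewrite mulmxBr -scalemxAr -/z.
  rewrite !(mxdotDl, mxdotDr, mxdotNl, mxdotNr, mxdotZl, mxdotZr).
  by rewrite -/z -/c xNz -/a Nx0; move=> h; lra.
have c1_gt0 : 0 < c + 1 by lra.
(* The quadratic in [key] is smallest at [t = a / c]. The added 1 keeps the denominator nonzero when
   [c = 0], and the value stays negative unless [a = 0]. *)
have := key (a / (c + 1)).
have -> : (a / (c + 1)) ^+ 2 * c - a / (c + 1) * a *+ 2
        = - (a / (c + 1)) ^+ 2 * (c + 2).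
  by field; rewrite gt_eqF.
move=> h; have /eqP : a / (c + 1) = 0.
  apply/eqP; rewrite -sqrf_eq0 eq_le sqr_ge0 andbT.
  have : (a / (c + 1)) ^+ 2 * (c + 2) <= 0 by lra.
  by rewrite pmulr_lle0 //; lra.
by rewrite mulf_eq0 invr_eq0 (gt_eqF c1_gt0) orbF => /eqP.
Qed.

End FrobeniusInnerProduct.

(** * The spectral theorem, by maximizing quadratic forms *)

Section SpectralTheorem.
Variable R : realType.

Lemma continuous_sumr (T : topologicalType) n (F : 'I_n -> T -> R) :
  (forall i, continuous (F i)) -> continuous (fun x => \sum_i F i x).
Proof.
move=> Fc; apply: continuous_big => [|i _]; last exact: Fc.
exact: add_continuous.
Qed.

Lemma continuous_mulr (T : topologicalType) (f g : T -> R) :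
  continuous f -> continuous g -> continuous (fun x => f x * g x).
Proof. by move=> fc gc x; apply: cvgM; [exact: fc|exact: gc]. Qed.

Lemma continuous_mxentry n (j : 'I_n) : continuous (fun x : 'rV[R]_n => x 0 j).
Proof. exact: coord_continuous. Qed.

Lemma continuous_quadratic n (S : 'M[R]_n) :
  continuous (fun x : 'rV[R]_n => mxdot x^T (S *m x^T)).
Proof.
have -> : (fun x : 'rV[R]_n => mxdot x^T (S *m x^T)) =
    (fun x => \sum_i \sum_j x 0 i * S i j * x 0 j).
  apply/funext => x; rewrite mxdotE big_ord1; apply: eq_bigr => i _.
  rewrite !mxE mulr_sumr; apply: eq_bigr => j _.
  by rewrite !mxE mulrA.
apply: continuous_sumr => i; apply: continuous_sumr => j.
apply: continuous_mulr; last exact: continuous_mxentry.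
by apply: continuous_mulr; [exact: continuous_mxentry|exact: cst_continuous].
Qed.

(** The columns of [B] are the eigenvectors found so far. Their orthogonal complement is nonzero and
    invariant under [S], and a maximizer of the quadratic form of [S] on its unit sphere is the next
    eigenvector. *)
Lemma symmetric_max_eigenvector n k (S : 'M[R]_n) (B : 'M[R]_(n, k))
    (d : 'rV[R]_k) : (k < n)%N -> S^T = S -> B^T *m B = 1%:M ->
  S *m B = B *m diag_mx d ->
  exists (x : 'cV[R]_n) a, [/\ mxdot x x = 1, B^T *m x = 0 & S *m x = a *: x].
Proof.
move=> lt_kn Ssym BB SB.
pose K := [set x : 'rV[R]_n | mxdot x^T x^T = 1 /\ x *m B = 0].
have K0 : K !=set0.
  have : kermx B != 0.
    rewrite -mxrank_eq0 mxrank_ker -lt0n subn_gt0.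
    by apply: leq_ltn_trans lt_kn; exact: rank_leq_col.
  move=> /rowV0Pn[v /sub_kermxP vB v0].
  have v_gt0 : 0 < mxdot v^T v^T by apply: mxdot_gt0; rewrite trmx_eq0.
  exists ((Num.sqrt (mxdot v^T v^T))^-1 *: v); split.
    rewrite linearZ /= mxdotZl mxdotZr mulrA -invfM -expr2 sqr_sqrtr ?ltW//.
    by rewrite mulVf// gt_eqF.
  by rewrite -scalemxAl vB scaler0.
have contn : continuous (fun x : 'rV[R]_n => mxdot x^T x^T).
  have := @continuous_quadratic n 1%:M.
  by under [X in continuous X -> _]eq_fun do rewrite mul1mx.
have Kcl : closed K.
  have -> : K = (fun x : 'rV[R]_n => mxdot x^T x^T) @^-1` [set 1] `&`
     \bigcap_(j in [set: 'I_k])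
       (fun x : 'rV[R]_n => \sum_i x 0 i * B i j) @^-1` [set 0].
    apply/seteqP; split => x.
      move=> [x1 xB]; split => // j _ /=.
      by have /rowP/(_ j) := xB; rewrite !mxE.
    move=> [x1 xB]; split => //; apply/rowP => j; rewrite !mxE.
    exact: (xB j).
  apply: closedI.
    apply: preimage_closed; last exact: closed_eq.
    by move=> x _; exact: contn.
  apply: closed_bigI => j _.
  apply: preimage_closed; last exact: closed_eq.
  move=> x _; apply: continuous_sumr => i.
  by apply: continuous_mulr; [exact: continuous_mxentry|exact: cst_continuous].
have Kbd : bounded_set K.
  exists 1; split => // M M1 x [x1 _].
  change (mx_norm x <= M); rewrite mx_normrE; apply/bigmax_leP; split => /=.
    by rewrite ltW // (lt_trans _ M1).
  move=> [i j] _ /=; rewrite ord1; apply: le_trans (ltW M1).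
  rewrite -[leRHS]sqrtr1 -sqrtr_sqr; apply: ler_wsqrtr.
  rewrite -x1 mxdotE big_ord1 (bigD1 j) //= !mxE -expr2 lerDl.
  by apply: sumr_ge0 => i' _; rewrite -expr2 sqr_ge0.
have [x xK xmax] := EVT_max_rV K0 (bounded_closed_compact Kbd Kcl)
  (continuous_subspaceT (@continuous_quadratic n S)).
move: xK xmax; rewrite inE => -[x1 xB] xmax.
set a := mxdot x^T (S *m x^T) in xmax.
have Bx : B^T *m x^T = 0 by rewrite -trmx_mul xB trmx0.
have SBx : B^T *m (S *m x^T) = 0.
  by rewrite mulmxA -Ssym -trmx_mul SB trmx_mul -mulmxA Bx mulmx0.
(* [P] is the orthogonal projector onto the complement. The form of [N] at [y] is
   [a |Py|^2 - <Py, S Py>]: nonnegative because [a] is the maximum, and zero at the maximizer. So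
   [psd_kernel] yields the eigenvector equation. *)
pose P := 1%:M - B *m B^T.
have Psym : P^T = P by rewrite /P linearB /= trmx1 trmx_mul trmxK.
have BP : B^T *m P = 0 by rewrite /P mulmxBr mulmx1 mulmxA BB mul1mx subrr.
have PP : P *m P = P.
  by rewrite {1}/P mulmxBl mul1mx -mulmxA BP mulmx0 subr0.
have Px : P *m x^T = x^T by rewrite /P mulmxBl mul1mx -mulmxA Bx mulmx0 subr0.
pose N := a *: P - P *m S *m P.
have NE (y : 'cV_n) : mxdot y (N *m y) =
    a * mxdot (P *m y) (P *m y) - mxdot (P *m y) (S *m (P *m y)).
  rewrite /N mulmxBl mxdotDr mxdotNr -scalemxAl mxdotZr !mxdot_mulAl Psym.
  by rewrite !mulmxA PP.
have : N *m x^T = 0.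
  apply: psd_kernel.
  - by rewrite /N linearB linearZ /= !trmx_mul Psym Ssym mulmxA.
  - move=> y; rewrite NE; set z := P *m y.
    have [->|z0] := eqVneq z 0; first by rewrite mulmx0 !mxdot0r mulr0 subr0.
    have := mxdot_gt0 z0; set b := mxdot z z => b_gt0.
    have /xmax : (Num.sqrt b)^-1 *: z^T \in K.
      rewrite inE; split.
        rewrite linearZ /= trmxK mxdotZl mxdotZr mulrA -invfM -expr2.
        by rewrite sqr_sqrtr ?ltW// mulVf// gt_eqF.
      rewrite -scalemxAl -[B]trmxK -trmx_mul /z mulmxA BP mul0mx trmx0.
      exact: scaler0.
    rewrite linearZ /= trmxK -scalemxAr mxdotZl mxdotZr mulrA -invfM -expr2.
    rewrite (sqr_sqrtr (ltW b_gt0)) ler_pdivrMl// [b * a]mulrC => h.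
    by rewrite subr_ge0.
  - by rewrite NE Px x1 mulr1 subrr.
rewrite /N mulmxBl -scalemxAl -!mulmxA Px => /eqP; rewrite subr_eq0 => /eqP Nx.
exists x^T, a; split => //.
by rewrite Nx /P mulmxBl mul1mx -mulmxA SBx mulmx0 subr0.
Qed.

(** Eigenvectors are appended one column at a time until [B] is square; then [B^T] is also a right
    inverse of [B]. *)
Theorem symmetric_diagonalization n (S : 'M[R]_n) : S^T = S ->
  exists (Q : 'M[R]_n) (d : 'rV[R]_n),
    Q^T *m Q = 1%:M /\ S = Q *m diag_mx d *m Q^T.
Proof.
move=> Ssym.
have [B [d [BB SB]]] : exists (B : 'M[R]_n) (d : 'rV[R]_n),
    B^T *m B = 1%:M /\ S *m B = B *m diag_mx d.
  suff H k : (k <= n)%N -> exists (B : 'M[R]_(n, k)) (d : 'rV[R]_k),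
    B^T *m B = 1%:M /\ S *m B = B *m diag_mx d by exact: H.
  elim: k => [_|k IH lt_kn].
    exists 0, 0; split; first by apply/matrixP => -[].
    by apply/matrixP => i -[].
  have [B [d [BB SB]]] := IH (ltnW lt_kn).
  have [x [a [x1 Bx Sx]]] := symmetric_max_eigenvector lt_kn Ssym BB SB.
  rewrite -addn1; exists (row_mx B x), (row_mx d a%:M); split.
    rewrite tr_row_mx mul_col_row BB Bx.
    have -> : x^T *m B = 0 by rewrite -[B]trmxK -trmx_mul Bx trmx0.
    have -> : x^T *m x = 1%:M.
      by apply/matrixP => i j; rewrite !ord1 -trace_mx11 [LHS]x1 mxE.
    by rewrite -scalar_mx_block.
  rewrite diag_mx_row mul_mx_row mul_row_block SB !mulmx0 addr0 add0r Sx.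
  congr row_mx; have -> : diag_mx (a%:M : 'rV[R]_1) = a%:M.
    by apply/matrixP => i j; rewrite !mxE !ord1 !eqxx.
  by rewrite mul_mx_scalar.
exists B, d; split => //.
by rewrite -SB -mulmxA (mulmx1C BB) mulmx1.
Qed.

End SpectralTheorem.

(** * Singular values and the norms built from them *)

Section SingularValues.
Variable R : realType.

Lemma diag_conj_mul n k (Q : 'M[R]_(n, k)) (d e : 'rV[R]_k) : Q^T *m Q = 1%:M ->
  (Q *m diag_mx d *m Q^T) *m (Q *m diag_mx e *m Q^T) =
  Q *m diag_mx (\row_i (d 0 i * e 0 i)) *m Q^T.
Proof.
move=> QQ; rewrite !mulmxA -(mulmxA (Q *m diag_mx d)) QQ mulmx1.
by rewrite -(mulmxA Q) mulmx_diag.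
Qed.

(** The rows of [Q^T] whose entry of [d] equals [a] form an orthonormal basis of the eigenspace.
    When [k < n] the matrix also vanishes off the column space of [Q]; [a != 0] keeps that part of
    the kernel out. *)
Lemma mxrank_eigenspace_diag n k (Q : 'M[R]_(n, k)) (d : 'rV[R]_k) a :
  Q^T *m Q = 1%:M -> a != 0 ->
  \rank (eigenspace (Q *m diag_mx d *m Q^T) a) = #|[pred i | d 0 i == a]|.
Proof.
move=> QQ a0; set A := [pred i | d 0 i == a]; set S := _ *m _ *m _.
pose E : 'M[R]_(#|A|, n) := rowsub (@enum_val _ A) Q^T.
have EE : E *m E^T = 1%:M.
  apply/matrixP => i j; have /matrixP/(_ (enum_val i) (enum_val j)) := QQ.
  rewrite !mxE (inj_eq enum_val_inj) => <-.
  by apply: eq_bigr => l _; rewrite !mxE.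
have QS : Q^T *m S = diag_mx d *m Q^T by rewrite /S !mulmxA QQ mul1mx.
have rowS i : row i Q^T *m S = d 0 i *: row i Q^T.
  by rewrite -row_mul QS row_mul row_diag_mx -scalemxAl -rowE.
have /eqmx_rank -> : (eigenspace S a == E)%MS; last first.
  by apply/eqP/row_freeP; exists E^T.
apply/andP; split; last first.
  apply/row_subP => i; apply/eigenspaceP.
  rewrite row_rowsub rowS; congr (_ *: _).
  by have := enum_valP i => /eqP.
apply/rV_subP => v /eigenspaceP vS.
(* Since [v] is [a^-1] times [v *m S], it lies in the row space of [Q^T]. By [yE] its coordinates
   vanish wherever [d 0 i] differs from [a]. *)
have vQ : v = (v *m Q) *m Q^T.
  apply: (scalerI a0); rewrite scalemxAl scalemxAl -vS.
  by rewrite /S -!mulmxA (mulmxA Q^T Q) QQ mul1mx.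
have yE i : (v *m Q) 0 i * d 0 i = a * (v *m Q) 0 i.
  have : v *m S *m Q = v *m Q *m diag_mx d.
    by rewrite /S -!mulmxA QQ mulmx1 !mulmxA.
  rewrite vS -scalemxAl => /rowP/(_ i).
  by rewrite mul_mx_diag !mxE => ->.
rewrite vQ mulmx_sum_row; apply: summx_sub => i _.
have [->|yi0] := eqVneq ((v *m Q) 0 i) 0; first by rewrite scale0r sub0mx.
apply: scalemx_sub.
have iA : i \in A.
  by rewrite inE; apply/eqP/(mulfI yi0); rewrite yE mulrC.
have -> : row i Q^T = row (enum_rank_in iA i) E.
  by rewrite row_rowsub enum_rankK_in.
exact: row_sub.
Qed.

(** * Gram diagonalizations with [k] columns, used below for [k] equal to [n], [minn m n] and [r] *)

Section Gram.
Variables (m n k : nat) (A : 'M[R]_(m, n)) (Q : 'M[R]_(n, k)) (d : 'rV[R]_k).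
Hypotheses (QQ : Q^T *m Q = 1%:M) (AQ : A^T *m A = Q *m diag_mx d *m Q^T).

Lemma singular_multE s : s != 0 ->
  singular_mult A s = #|[pred i | d 0 i == s ^+ 2]|.
Proof.
by move=> s0; rewrite /singular_mult AQ mxrank_eigenspace_diag ?expf_neq0.
Qed.

Lemma singular_valuesE s : 0 < s ->
  singular_values A s <-> exists i, d 0 i = s ^+ 2.
Proof.
move=> s_gt0; have s0 : s != 0 by rewrite gt_eqF.
have -> : singular_values A s <-> (0 < singular_mult A s)%N.
  rewrite lt0n mxrank_eq0; split => [[_ //]|h].
  by split => //; exact: ltW.
rewrite singular_multE //; split.
  by move/card_gt0P => -[i /eqP di]; exists i.
by move=> [i di]; apply/card_gt0P; exists i; rewrite inE di.
Qed.

Lemma gram_diag_norm i : mxdot (A *m col i Q) (A *m col i Q) = d 0 i.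
Proof.
rewrite colE mxdot_mulAl mulmxA AQ mxdot_mulAl -!mulmxA (mulmxA Q^T Q) QQ.
rewrite mul1mx (mulmxA Q^T Q) QQ mul1mx mxdotE big_ord1 (bigD1 i) //= big1.
  by rewrite mul_diag_mx !mxE !eqxx mul1r mulr1 addr0.
by move=> j ji; rewrite !mxE (negbTE ji) mul0r.
Qed.

Lemma gram_diag_ge0 i : 0 <= d 0 i.
Proof. by rewrite -gram_diag_norm mxdot_ge0. Qed.

(** The definition sums over distinct singular values weighted by multiplicity, the right-hand side
    over a list [t] with repetitions; the two are matched on the positive values. *)
Lemma nuclear_normE : nuclear_norm A = \sum_i Num.sqrt (d 0 i).
Proof.
pose t := [seq Num.sqrt (d 0 i) | i : 'I_k].
have sqrtE i s : 0 <= s -> (Num.sqrt (d 0 i) == s) = (d 0 i == s ^+ 2).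
  move=> s0; rewrite -(@eqrXn2 _ 2 _ s) ?sqrtr_ge0// sqr_sqrtr//.
  exact: gram_diag_ge0.
have t_ge0 s : s \in t -> 0 <= s by move=> /mapP[i _ ->]; exact: sqrtr_ge0.
have tE s : 0 < s -> s \in t <-> singular_values A s.
  move=> s_gt0; rewrite singular_valuesE//; split.
    move=> /mapP[i _ si]; exists i; apply/eqP.
    by rewrite -sqrtE ?ltW// -si.
  move=> [i /eqP]; rewrite -(sqrtE _ _ (ltW s_gt0)) => /eqP <-.
  by apply: map_f; rewrite mem_enum.
have countE s : s != 0 -> s \in t -> singular_mult A s = count_mem s t.
  move=> s0 st; rewrite singular_multE// count_map cardE size_filter enumT.
  by apply: eq_count => i; rewrite /= inE sqrtE ?t_ge0.
(* The multiplicity of 0 may differ from its count in [t], but 0 contributes nothing to either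
   sum. *)
pose S := [set s | 0 < s /\ s \in t].
rewrite /nuclear_norm -(fsbig_widen S); first last.
- move=> s [[s_ge0 sv] /= sS]; apply/eqP.
  have [->|s0] := eqVneq s 0; first by rewrite mul0rn.
  have s_gt0 : 0 < s by rewrite lt_neqAle eq_sym s0.
  by exfalso; apply: sS; split => //; apply/tE.
- by move=> s [s_gt0 st]; exact/tE.
rewrite (eq_fsbigr (fun s => s *+ count_mem s t)); last first.
  by move=> s; rewrite inE => -[s_gt0 st]; rewrite countE// gt_eqF.
rewrite (fsbig_widen S [set` undup t]); first last.
- move=> s /= []; rewrite mem_undup => st sS; apply/eqP.
  have [->|s0] := eqVneq s 0; first by rewrite mul0rn.
  by exfalso; apply: sS; split => //; rewrite lt_neqAle eq_sym s0 t_ge0.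
- by move=> s [_ st] /=; rewrite mem_undup.
(* Adding the distinct entries of [t] weighted by their counts amounts to adding all entries of
   [t]. *)
rewrite -fsbig_seq ?undup_uniq//.
have /= -> := @big_undup_iterop_count R 0 +%R R t xpredT id.
by rewrite big_map big_enum.
Qed.

End Gram.

Lemma gram_diagonalization m n (A : 'M[R]_(m, n)) :
  exists (Q : 'M[R]_n) (d : 'rV[R]_n),
    Q^T *m Q = 1%:M /\ A^T *m A = Q *m diag_mx d *m Q^T.
Proof. by apply: symmetric_diagonalization; rewrite trmx_mul trmxK. Qed.

Lemma has_ubound_singular_values m n (A : 'M[R]_(m, n)) :
  has_ubound (singular_values A).
Proof.
have [Q [d [QQ AQ]]] := gram_diagonalization A.
exists (\sum_i Num.sqrt (d 0 i)) => s [s_ge0 sv].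
have [->|s0] := eqVneq s 0; first by apply: sumr_ge0 => i _; exact: sqrtr_ge0.
have s_gt0 : 0 < s by rewrite lt_neqAle eq_sym s0.
have [i di] : exists i, d 0 i = s ^+ 2 by apply/(singular_valuesE QQ AQ).
rewrite (bigD1 i) //= di sqrtr_sqr ger0_norm// lerDl.
by apply: sumr_ge0 => j _; exact: sqrtr_ge0.
Qed.

Lemma singular_value_le m n (A : 'M[R]_(m, n)) s :
  singular_values A s -> s <= spectral_norm A.
Proof. by move=> As; apply: ub_le_sup => //; exact: has_ubound_singular_values. Qed.

Lemma spectral_norm_ge0 m n (A : 'M[R]_(m, n)) : 0 <= spectral_norm A.
Proof.
have [[s As]|/set0P/negP] := pselect (singular_values A !=set0).
  by apply: le_trans (singular_value_le As); case: As.
by rewrite negbK /spectral_norm => /eqP ->; rewrite sup0.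
Qed.

Lemma gram_diag_le m n k (A : 'M[R]_(m, n)) (Q : 'M[R]_(n, k)) (d : 'rV[R]_k) :
  Q^T *m Q = 1%:M -> A^T *m A = Q *m diag_mx d *m Q^T ->
  forall i, d 0 i <= spectral_norm A ^+ 2.
Proof.
move=> QQ AQ i; have := gram_diag_ge0 QQ AQ i.
rewrite le_eqVlt => /orP[/eqP <-|di_gt0]; first by rewrite sqr_ge0.
rewrite -[leLHS](sqr_sqrtr (ltW di_gt0)) ler_pXn2r ?nnegrE ?sqrtr_ge0 ?spectral_norm_ge0//.
apply/singular_value_le/(singular_valuesE QQ AQ); first by rewrite sqrtr_gt0.
by exists i; rewrite sqr_sqrtr// ltW.
Qed.

(** In the coordinates [Q^T *m B] the Gram matrix of [A] is diagonal, with entries at most the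
    squared spectral norm. *)
Lemma mxdot_mul_le m n p (A : 'M[R]_(m, n)) (B : 'M[R]_(n, p)) :
  mxdot (A *m B) (A *m B) <= spectral_norm A ^+ 2 * mxdot B B.
Proof.
have [Q [d [QQ AQ]]] := gram_diagonalization A.
have -> : mxdot B B = mxdot (Q^T *m B) (Q^T *m B).
  by rewrite mxdot_mulAl trmxK mulmxA (mulmx1C QQ) mul1mx.
rewrite mxdot_mulAl mulmxA AQ -!mulmxA -[Q in X in X <= _]trmxK -mxdot_mulAl.
rewrite trmxK !mxdotE mulr_sumr; apply: ler_sum => j _.
rewrite mulr_sumr; apply: ler_sum => i _.
rewrite mul_diag_mx [X in _ * X <= _]mxE mulrCA -expr2 ler_wpM2r ?sqr_ge0//.
exact: gram_diag_le AQ i.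
Qed.

Lemma spectral_norm_le m n (A : 'M[R]_(m, n)) c : 0 <= c ->
  (forall v : 'cV[R]_n, mxdot (A *m v) (A *m v) <= c ^+ 2 * mxdot v v) ->
  spectral_norm A <= c.
Proof.
move=> c_ge0 Ac; have [A0|/set0P/negP] := pselect (singular_values A !=set0);
  last by rewrite negbK /spectral_norm => /eqP ->; rewrite sup0.
apply: ge_sup => // s [s_ge0 /eigenvalueP[v vA v0]].
rewrite -(@ler_pXn2r _ 2) ?nnegrE//.
have v_gt0 : 0 < mxdot v^T v^T by rewrite mxdot_gt0 ?trmx_eq0.
rewrite -(ler_pM2r v_gt0); apply: le_trans (Ac v^T).
rewrite mxdot_mulAl mulmxA.
(* [eigenvalue] provides row eigenvectors; the symmetry of the Gram matrix turns them into
   columns. *)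
have -> : A^T *m A *m v^T = s ^+ 2 *: v^T.
  by rewrite -linearZ -vA /= !trmx_mul trmxK.
by rewrite mxdotZr.
Qed.

End SingularValues.

(** * Duality of the nuclear and spectral norms, with its equality case *)

Section NuclearSpectralDuality.
Variable R : realType.

Lemma col_mulmx m n p (A : 'M[R]_(m, n)) (B : 'M[R]_(n, p)) j :
  col j (A *m B) = A *m col j B.
Proof. by rewrite !colE mulmxA. Qed.

Lemma mxdot_le_sqrt m n (A B : 'M[R]_(m, n)) :
  mxdot A B <= Num.sqrt (mxdot A A) * Num.sqrt (mxdot B B).
Proof.
apply: le_trans (ler_norm _) _.
rewrite -sqrtrM ?mxdot_ge0// -sqrtr_sqr.
exact/ler_wsqrtr/mxdot_sqr_le.
Qed.

Lemma mxdot_col_orthonormal n k (Q : 'M[R]_(n, k)) i : Q^T *m Q = 1%:M ->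
  mxdot (col i Q) (col i Q) = 1.
Proof.
move=> /matrixP/(_ i i); rewrite !mxE eqxx mulr1n => <-.
by rewrite mxdotE big_ord1; apply: eq_bigr => j _; rewrite !mxE.
Qed.

Lemma mxdot_gram m n (A B : 'M[R]_(m, n)) (Q : 'M[R]_n) : Q^T *m Q = 1%:M ->
  mxdot A B = \sum_j mxdot (A *m col j Q) (B *m col j Q).
Proof.
move=> QQ; have -> : mxdot A B = mxdot (A *m Q) (B *m Q).
  by rewrite mxdot_mulAr -mulmxA (mulmx1C QQ) mulmx1.
by rewrite mxdot_col; apply: eq_bigr => j _; rewrite !col_mulmx.
Qed.

Lemma mxdot_mul_unit_le m n (A : 'M[R]_(m, n)) (v : 'cV[R]_n) : mxdot v v = 1 ->
  Num.sqrt (mxdot (A *m v) (A *m v)) <= spectral_norm A.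
Proof.
move=> v1; rewrite -[leRHS]ger0_norm ?spectral_norm_ge0// -sqrtr_sqr.
by apply: ler_wsqrtr; rewrite -[leRHS]mulr1 -v1 mxdot_mul_le.
Qed.

Lemma mxdot_gram_le m n k (X Z : 'M[R]_(m, n)) (Q : 'M[R]_(n, k)) (d : 'rV[R]_k) i :
  Q^T *m Q = 1%:M -> X^T *m X = Q *m diag_mx d *m Q^T ->
  mxdot (X *m col i Q) (Z *m col i Q) <= Num.sqrt (d 0 i) * spectral_norm Z.
Proof.
move=> QQ XQ; apply: le_trans (mxdot_le_sqrt _ _) _.
rewrite (gram_diag_norm QQ XQ) ler_wpM2l ?sqrtr_ge0//.
exact/mxdot_mul_unit_le/mxdot_col_orthonormal.
Qed.

(** In an orthonormal eigenbasis of [X^T *m X] the inner product splits into one term per basis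
    vector, and Cauchy-Schwarz bounds each term. *)
Theorem mxdot_nuclear_spectral_le m n (X Z : 'M[R]_(m, n)) :
  mxdot X Z <= nuclear_norm X * spectral_norm Z.
Proof.
have [Q [d [QQ XQ]]] := gram_diagonalization X.
rewrite (nuclear_normE QQ XQ) mulr_suml (mxdot_gram _ _ QQ).
by apply: ler_sum => i _; exact: mxdot_gram_le.
Qed.

(** [W] is the partial isometry in the polar decomposition of [X], that is, [X] times the
    pseudo-inverse of the square root of [X^T *m X]. *)
Theorem nuclear_norm_attained m n (X : 'M[R]_(m, n)) :
  exists W : 'M[R]_(m, n), spectral_norm W <= 1 /\ mxdot X W = nuclear_norm X.
Proof.
have [Q [d [QQ XQ]]] := gram_diagonalization X.
have d_ge0 := gram_diag_ge0 QQ XQ.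
(* The convention that the inverse of 0 is 0 makes this the pseudo-inverse. *)
pose e := \row_i (Num.sqrt (d 0 i))^-1.
exists (X *m Q *m diag_mx e *m Q^T); split.
  apply: spectral_norm_le => // v; rewrite expr1n mul1r.
  have -> : mxdot v v = mxdot (Q^T *m v) (Q^T *m v).
    by rewrite mxdot_mulAl trmxK mulmxA (mulmx1C QQ) mul1mx.
  rewrite -!mulmxA; set y := Q^T *m v.
  rewrite mxdot_mulAl (mulmxA X^T) XQ mxdot_mulAl -!mulmxA (mulmxA Q^T Q) QQ mul1mx.
  rewrite (mulmxA Q^T Q) QQ mul1mx !mxdotE; apply: ler_sum => j _.
  apply: ler_sum => i _; rewrite !mul_diag_mx !mxE.
  have -> (a b c : R) : a * b * (c * (a * b)) = (a ^+ 2 * c) * (b * b) by ring.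
  rewrite -[leRHS]mul1r -expr2 ler_wpM2r ?sqr_ge0// exprVn sqr_sqrtr//.
  have [->|d0] := eqVneq (d 0 i) 0; first by rewrite mulr0.
  by rewrite mulVf.
rewrite mxdotC mxdot_mulAr trmxK mxdotC mxdot_col (nuclear_normE QQ XQ).
apply: eq_bigr => i _.
have -> : col i (X *m Q *m diag_mx e) = e 0 i *: (X *m col i Q).
  by apply/colP => j; rewrite -col_mulmx mul_mx_diag !mxE mulrC.
rewrite col_mulmx mxdotZr (gram_diag_norm QQ XQ) mxE.
have [->|d0] := eqVneq (d 0 i) 0; first by rewrite sqrtr0 mulr0.
have s0 : Num.sqrt (d 0 i) != 0 by rewrite sqrtr_eq0 -ltNge lt_neqAle eq_sym d0 d_ge0.
by rewrite -[X in _ * X](sqr_sqrtr (d_ge0 i)) expr2 mulKf.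
Qed.

Lemma nuclear_norm_ge0 m n (X : 'M[R]_(m, n)) : 0 <= nuclear_norm X.
Proof.
have [Q [d [QQ XQ]]] := gram_diagonalization X.
by rewrite (nuclear_normE QQ XQ); apply: sumr_ge0 => i _; exact: sqrtr_ge0.
Qed.

Lemma mxdot_le_nuclear_norm m n (X W : 'M[R]_(m, n)) : spectral_norm W <= 1 ->
  mxdot X W <= nuclear_norm X.
Proof.
move=> W1; apply: le_trans (mxdot_nuclear_spectral_le _ _) _.
by rewrite -[leRHS]mulr1 ler_wpM2l ?nuclear_norm_ge0.
Qed.

(** The nuclear norm is a maximum of linear functionals, so the maximizer for the sum serves as a
    test matrix for both summands. *)
Lemma nuclear_normD m n (X Y : 'M[R]_(m, n)) :
  nuclear_norm (X + Y) <= nuclear_norm X + nuclear_norm Y.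
Proof.
have [W [W1 <-]] := nuclear_norm_attained (X + Y).
by rewrite mxdotDl lerD// mxdot_le_nuclear_norm.
Qed.

Lemma nuclear_normZ m n c (X : 'M[R]_(m, n)) : 0 <= c ->
  nuclear_norm (c *: X) <= c * nuclear_norm X.
Proof.
move=> c0; have [W [W1 <-]] := nuclear_norm_attained (c *: X).
by rewrite mxdotZl ler_wpM2l// mxdot_le_nuclear_norm.
Qed.

Lemma nuclear_norm0 m n : nuclear_norm (0 : 'M[R]_(m, n)) = 0.
Proof.
apply/eqP; rewrite eq_le nuclear_norm_ge0 andbT.
by have := nuclear_normZ (0 : 'M[R]_(m, n)) (lexx 0); rewrite mul0r scaler0.
Qed.

Lemma nuclear_norm_gt0 m n (X : 'M[R]_(m, n)) : X != 0 -> 0 < nuclear_norm X.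
Proof.
move=> X0; rewrite lt_neqAle nuclear_norm_ge0 andbT eq_sym.
apply: contra_neq X0 => nX0; apply: mxdot_eq0; apply/eqP.
rewrite eq_le mxdot_ge0 andbT.
by have := mxdot_nuclear_spectral_le X X; rewrite nX0 mul0r.
Qed.

(* Testing against the rank one matrices (W v) v^T. *)
Lemma spectral_norm_le1 m n (W : 'M[R]_(m, n)) :
  (forall X, mxdot X W <= nuclear_norm X) -> spectral_norm W <= 1.
Proof.
move=> Wle; apply: spectral_norm_le => // v; rewrite expr1n mul1r.
set u := W *m v; set a := mxdot u u; set b := mxdot v v.
have a_ge0 : 0 <= a by exact: mxdot_ge0.
have b_ge0 : 0 <= b by exact: mxdot_ge0.
have : a <= Num.sqrt a * Num.sqrt b.
  have {1}-> : a = mxdot (u *m v^T) W by rewrite mxdot_mulAr trmxK.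
  apply: le_trans (Wle _) _.
  have [W' [W'1 <-]] := nuclear_norm_attained (u *m v^T).
  rewrite mxdot_mulAr trmxK; apply: le_trans (mxdot_le_sqrt _ _) _.
  rewrite -/a ler_wpM2l ?sqrtr_ge0// ler_wsqrtr//.
  apply: le_trans (mxdot_mul_le _ _) _.
  rewrite -[leRHS]mul1r ler_wpM2r ?mxdot_ge0//.
  by rewrite expr_le1 ?spectral_norm_ge0.
rewrite -sqrtrM// => h.
have : a ^+ 2 <= a * b.
  rewrite -[leRHS]sqr_sqrtr ?mulr_ge0//.
  by rewrite ler_pXn2r ?nnegrE ?sqrtr_ge0.
move: a_ge0; rewrite le_eqVlt => /orP[/eqP <- //|a_gt0].
by rewrite expr2 ler_pM2l.
Qed.

(* Equality in [mxdot_gram_le] forces equality both in Cauchy-Schwarz and in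
   |Z q| <= ||Z||_2 for the unit vector q = col i Q. *)
Lemma mxdot_gram_eq m n k (X Z : 'M[R]_(m, n)) (Q : 'M[R]_(n, k)) (d : 'rV[R]_k) i :
  Q^T *m Q = 1%:M -> X^T *m X = Q *m diag_mx d *m Q^T -> 0 < spectral_norm Z ->
  mxdot (X *m col i Q) (Z *m col i Q) = Num.sqrt (d 0 i) * spectral_norm Z ->
  X *m col i Q = (Num.sqrt (d 0 i) / spectral_norm Z) *: (Z *m col i Q) /\
  (d 0 i != 0 -> Z^T *m Z *m col i Q = spectral_norm Z ^+ 2 *: col i Q).
Proof.
set s := spectral_norm Z; set q := col i Q; set t := Num.sqrt _.
move=> QQ XQ s_gt0 eqXZ.
have dt : d 0 i = t ^+ 2 by rewrite sqr_sqrtr// (gram_diag_ge0 QQ XQ).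
have q1 : mxdot q q = 1 by exact: mxdot_col_orthonormal.
have XX : mxdot (X *m q) (X *m q) = t ^+ 2 by rewrite (gram_diag_norm QQ XQ).
have ZZ : mxdot (Z *m q) (Z *m q) <= s ^+ 2.
  by rewrite -[leRHS]mulr1 -q1 mxdot_mul_le.
set b := mxdot (Z *m q) (Z *m q) in ZZ.
have s0 : s != 0 by rewrite gt_eqF.
(* The squared norm of the difference is [(t / s) ^+ 2 * (b - s ^+ 2)], which is at most 0. *)
have eqXq : X *m q = (t / s) *: (Z *m q).
  apply/eqP; rewrite -subr_eq0; apply/eqP/mxdot_eq0/eqP.
  rewrite eq_le mxdot_ge0 andbT.
  rewrite !(mxdotDl, mxdotDr, mxdotNl, mxdotNr, mxdotZl, mxdotZr).
  rewrite (mxdotC (Z *m q) (X *m q)) XX eqXZ -/b.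
  have -> : t ^+ 2 + - (t / s * (t * s)) + (- (t / s * (t * s)) + - - (t / s * (t / s * b)))
     = (t / s) ^+ 2 * (b - s ^+ 2) by field.
  by rewrite mulr_ge0_le0 ?sqr_ge0// subr_le0.
split => // d0.
have bE : b = s ^+ 2.
  have := XX; rewrite eqXq mxdotZl mxdotZr -/b => tb.
  have t0 : t != 0 by apply: contra d0; rewrite dt => /eqP ->; rewrite expr0n.
  have : (t / s) ^+ 2 * b = (t / s) ^+ 2 * s ^+ 2 by rewrite expr2 -mulrA tb; field.
  by apply: mulfI; rewrite expf_neq0// mulf_neq0// invr_neq0.
(* [N] is positive semidefinite and its form vanishes at [q], so [psd_kernel] makes [q] an
   eigenvector. *)
pose N := (s ^+ 2)%:M - Z^T *m Z.
have NE (y : 'cV_n) : mxdot y (N *m y) = s ^+ 2 * mxdot y y - mxdot (Z *m y) (Z *m y).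
  by rewrite mulmxBl mul_scalar_mx mxdotDr mxdotNr mxdotZr -mulmxA -mxdot_mulAl.
suff : N *m q = 0.
  by rewrite mulmxBl mul_scalar_mx => /eqP; rewrite subr_eq0 => /eqP ->.
apply: psd_kernel => [|y|].
- by rewrite linearB /= tr_scalar_mx trmx_mul trmxK.
- by rewrite NE subr_ge0 mxdot_mul_le.
- by rewrite NE q1 mulr1 -/b bE subrr.
Qed.

Theorem nuclear_spectral_eq m n r (X Z : 'M[R]_(m, n)) (U : 'M[R]_(m, r))
    (V : 'M[R]_(n, r)) : 0 < spectral_norm Z ->
  Z *m V = spectral_norm Z *: U ->
  (forall b : 'cV[R]_n, Z^T *m Z *m b = spectral_norm Z ^+ 2 *: b ->
    V *m V^T *m b = b) ->
  mxdot X Z = nuclear_norm X * spectral_norm Z ->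
  exists2 T : 'M[R]_r, psdmx T & X = U *m T *m V^T.
Proof.
set s := spectral_norm Z => s_gt0 ZV leadV.
have [Q [d [QQ XQ]]] := gram_diagonalization X.
rewrite (nuclear_normE QQ XQ) mulr_suml (mxdot_gram _ _ QQ) => eqXZ.
(* Each term is bounded by [mxdot_gram_le] and the sums agree, so every bound is attained. *)
have eq_i i : mxdot (X *m col i Q) (Z *m col i Q) = Num.sqrt (d 0 i) * s.
  apply/eqP; rewrite eq_sym -subr_eq0; apply/eqP.
  have /eqP := eqXZ; rewrite eq_sym -subr_eq0 -sumrB psumr_eq0.
    by move/allP/(_ i (mem_index_enum _))/eqP.
  by move=> j _; rewrite subr_ge0 mxdot_gram_le.
pose D := diag_mx (map_mx Num.sqrt d).
have colD p (B : 'M[R]_(p, n)) i : col i (B *m D) = Num.sqrt (d 0 i) *: col i B.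
  by apply/colP => j; rewrite mul_mx_diag !mxE mulrC.
(* Columns of [Q] with [d 0 i] nonzero are fixed by [V *m V^T]; the others are annihilated by
   [D]. *)
have VQD : V *m V^T *m (Q *m D) = Q *m D.
  apply/matrixP => j i; suff /colP/(_ j) : col i (V *m V^T *m (Q *m D)) = col i (Q *m D).
    by rewrite !mxE.
  rewrite mulmxA colD colD col_mulmx.
  have [->|d0] := eqVneq (d 0 i) 0; first by rewrite sqrtr0 !scale0r.
  congr (_ *: _); apply: leadV.
  by have [_ ->] := mxdot_gram_eq QQ XQ s_gt0 (eq_i i).
have XQE : X *m Q = s^-1 *: (Z *m (Q *m D)).
  apply/matrixP => j i.
  suff /colP/(_ j) : col i (X *m Q) = col i (s^-1 *: (Z *m (Q *m D))).
    by rewrite !mxE.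
  rewrite col_mulmx; have [-> _] := mxdot_gram_eq QQ XQ s_gt0 (eq_i i).
  by rewrite linearZ /= mulmxA colD col_mulmx scalerA mulrC.
exists (V^T *m (Q *m D *m Q^T) *m V).
  split; first by rewrite !trmx_mul trmxK trmxK tr_diag_mx !mulmxA.
  move=> x; set y := Q^T *m V *m x.
  have -> : x^T *m (V^T *m (Q *m D *m Q^T) *m V) *m x = y^T *m (D *m y).
    by rewrite /y !trmx_mul trmxK !mulmxA.
  rewrite mxE; apply: sumr_ge0 => i _; rewrite mul_diag_mx !mxE mulrCA.
  by rewrite mulr_ge0 ?sqrtr_ge0// -expr2 sqr_ge0.
have -> : X = X *m Q *m Q^T by rewrite -mulmxA (mulmx1C QQ) mulmx1.
(* Here [X] is [s^-1] times [Z *m (Q *m D *m Q^T)]. The factor [V *m V^T] is inserted on the left by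
   [VQD], where [Z *m V] becomes [s *: U], and on the right by its transpose. *)
rewrite XQE -[Q *m D in LHS]VQD -!scalemxAl !mulmxA ZV -!scalemxAl scalerA.
rewrite mulVf ?gt_eqF// scale1r -!mulmxA; congr (U *m (V^T *m (Q *m _))).
have := congr1 trmx VQD; rewrite !trmx_mul trmxK tr_diag_mx => {1}<-.
by rewrite !mulmxA.
Qed.

Lemma psd_diagonalization r (T : 'M[R]_r) : psdmx T ->
  exists (Q : 'M[R]_r) (t : 'rV[R]_r),
    [/\ Q^T *m Q = 1%:M, forall i, 0 <= t 0 i & T = Q *m diag_mx t *m Q^T].
Proof.
move=> [Tsym T_ge0]; have [Q [t [QQ TE]]] := symmetric_diagonalization Tsym.
exists Q, t; split => // i.
have := T_ge0 (col i Q); rewrite TE colE trmx_mul !mulmxA.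
rewrite -(mulmxA _ Q^T Q) QQ mulmx1 -(mulmxA _ Q^T Q) QQ mulmx1.
rewrite -colE mxE mul_mx_diag mxE.
by rewrite !mxE !eqxx mul1r.
Qed.

(** The Gram matrix is [V *m (T *m T) *m V^T]; diagonalizing [T] by [Q] diagonalizes it by [V *m Q],
    with the squared eigenvalues of [T]. *)
Lemma nuclear_norm_psd m n r (U : 'M[R]_(m, r)) (V : 'M[R]_(n, r)) (T : 'M[R]_r) :
  U^T *m U = 1%:M -> V^T *m V = 1%:M -> psdmx T ->
  nuclear_norm (U *m T *m V^T) = \tr T.
Proof.
move=> UU VV /psd_diagonalization[Q [t [QQ t_ge0 TE]]].
have VQ : (V *m Q)^T *m (V *m Q) = 1%:M.
  by rewrite trmx_mul -mulmxA (mulmxA V^T) VV mul1mx.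
have Tsym : T^T = T by rewrite TE !trmx_mul trmxK tr_diag_mx mulmxA.
have XX : (U *m T *m V^T)^T *m (U *m T *m V^T) =
    V *m Q *m diag_mx (\row_i (t 0 i * t 0 i)) *m (V *m Q)^T.
  rewrite !trmx_mul trmxK Tsym -!mulmxA (mulmxA U^T U) UU mul1mx.
  rewrite (mulmxA T T) {1 2}TE diag_conj_mul// !mulmxA.
  by [].
rewrite (nuclear_normE VQ XX) TE mxtrace_mulC mulmxA QQ mul1mx mxtrace_diag.
by apply: eq_bigr => i _; rewrite mxE -expr2 sqrtr_sqr ger0_norm.
Qed.

End NuclearSpectralDuality.

(** * Sublinear functionals and a Hahn-Banach sandwich *)

Section SublinearExtension.
Variable R : realType.

Definition sublinear (V : lmodType R) (p : V -> R) :=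
  (forall x y, p (x + y) <= p x + p y) /\
  (forall t x, 0 <= t -> p (t *: x) <= t * p x).

Lemma sublinear_ge0 (V : lmodType R) (p : V -> R) : sublinear p -> 0 <= p 0.
Proof. by move=> [pD _]; have := pD 0 0; rewrite addr0; lra. Qed.

Lemma sublinearZ (V : lmodType R) (p : V -> R) t x : sublinear p -> 0 <= t ->
  p (t *: x) = t * p x.
Proof.
move=> ps; have [pD pZ] := ps; rewrite le_eqVlt => /orP[/eqP <-|t_gt0].
  rewrite mul0r; apply/eqP; rewrite eq_le scale0r sublinear_ge0// andbT.
  by have := pZ 0 0 (lexx 0); rewrite scale0r mul0r.
apply/eqP; rewrite eq_le (pZ _ _ (ltW t_gt0)) /= -ler_pdivlMl//.
rewrite -{1}[x](scalerK (lt0r_neq0 t_gt0)).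
by apply: pZ; rewrite invr_ge0 ltW.
Qed.

(** [G k c] prescribes the lower bound [c] at [k] for the functional sought; these prescriptions
    form a convex cone. *)
Definition cone_below (V : lmodType R) (p : V -> R) (G : V -> R -> Prop) :=
  [/\ G 0 0, (forall k c k' c', G k c -> G k' c' -> G (k + k') (c + c')),
      (forall t k c, 0 < t -> G k c -> G (t *: k) (t * c))
    & forall k c, G k c -> c <= p k].

(** The witness [q x] is the infimum of [p (x + k) - c] over [G k c]. It is finite because
    [c <= p k <= p (- x) + p (x + k)]. *)
Lemma sublinear_below (V : lmodType R) (p : V -> R) (G : V -> R -> Prop) :
  sublinear p -> cone_below p G ->
  exists q : V -> R, [/\ sublinear q, forall x, q x <= p x
    & forall k c, G k c -> q (- k) <= - c].
Proof.
move=> ps [G0 GD GZ Gp]; have [pD pZ] := ps.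
pose E x := [set a | exists k c, G k c /\ a = p (x + k) - c].
pose q x := inf (E x).
have E_lb x : lbound (E x) (- p (- x)).
  move=> _ [k [c [Gkc ->]]]; have := Gp _ _ Gkc.
  by have := pD (- x) (x + k); rewrite addrA addNr add0r; lra.
have q_le x k c : G k c -> q x <= p (x + k) - c.
  move=> Gkc; apply: ge_inf; last by exists k, c.
  by exists (- p (- x)); exact: E_lb.
have q_ge x b : (forall k c, G k c -> b <= p (x + k) - c) -> b <= q x.
  move=> bE; apply: lb_le_inf; first by exists (p (x + 0) - 0), 0, 0.
  by move=> _ [k [c [Gkc ->]]]; exact: bE.
exists q; split; last first.
- move=> k c Gkc; have := q_le (- k) _ _ Gkc; rewrite addNr.
  have := pZ 0 0 (lexx 0); rewrite scale0r mul0r; lra.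
- by move=> x; have := q_le x _ _ G0; rewrite addr0 subr0.
split.
  move=> x y; rewrite -lerBlDr; apply: (q_ge) => k c Gkc.
  rewrite lerBlDr -lerBlDl; apply: (q_ge) => k' c' Gkc'.
  have := q_le (x + y) _ _ (GD _ _ _ _ Gkc Gkc'); rewrite addrACA.
  by have := pD (x + k) (y + k'); lra.
move=> t x; rewrite le_eqVlt => /orP[/eqP <-|t_gt0].
  rewrite scale0r mul0r; have := q_le 0 _ _ G0; rewrite addr0.
  have := pZ 0 0 (lexx 0); rewrite scale0r mul0r; lra.
rewrite -ler_pdivrMl//; apply: (q_ge) => k c Gkc.
rewrite ler_pdivrMl// mulrBr; have := q_le (t *: x) _ _ (GZ _ _ _ t_gt0 Gkc).
by rewrite -scalerDr (sublinearZ _ ps (ltW t_gt0)).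
Qed.

(** Prescribing the bound [q e] on the ray through [e] gives [q' (- e) <= - q e <= - q' e]. Passing
    to a smaller functional preserves this inequality at the vectors treated before. *)
Lemma sublinear_linear_on (V : lmodType R) (p : V -> R) (s : seq V) :
  sublinear p -> exists q : V -> R, [/\ sublinear q, forall x, q x <= p x
    & forall e, e \in s -> q (- e) <= - q e].
Proof.
move=> ps; elim: s => [|e s [q [qs qp qlin]]]; first by exists p; split.
pose G k c := exists2 t, 0 <= t & k = t *: e /\ c = t * q e.
have Gcone : cone_below q G.
  split.
  - by exists 0 => //; rewrite scale0r mul0r.
  - move=> _ _ _ _ [t t0 [-> ->]] [u u0 [-> ->]].
    by exists (t + u); [exact: addr_ge0|rewrite scalerDl mulrDl].
  - move=> t _ _ t0 [u u0 [-> ->]]; exists (t * u); first exact: mulr_ge0 (ltW t0) u0.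
    by rewrite scalerA mulrA.
  - by move=> _ _ [t t0 [-> ->]]; rewrite sublinearZ.
have [q' [q's q'q q'G]] := sublinear_below qs Gcone.
exists q'; split => // [x|f]; first exact: le_trans (q'q _) (qp _).
rewrite inE => /orP[/eqP ->|fs].
  apply: le_trans (q'G e (q e) _) _; last by rewrite lerN2.
  by exists 1 => //; rewrite scale1r mul1r.
apply: le_trans (q'q _) _; apply: le_trans (qlin _ fs) _.
by rewrite lerN2.
Qed.

(* Finite-dimensional Hahn-Banach. *)
Theorem linear_sandwich (V : vectType R) (p : V -> R) (G : V -> R -> Prop) :
  sublinear p -> cone_below p G ->
  exists f : V -> R, [/\ forall x y, f (x + y) = f x + f y,
    forall t x, f (t *: x) = t * f x, forall x, f x <= p x
    & forall k c, G k c -> c <= f k].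
Proof.
move=> ps Gp; have [q [qs qp qG]] := sublinear_below ps Gp.
have [f [fs fq flin]] := sublinear_linear_on (vbasis (fullv : {vspace V})) qs.
have [fD fZ] := fs.
have f0 : f 0 = 0 by rewrite -(scale0r 0) sublinearZ// mul0r.
have fN_ge x : - f x <= f (- x) by have := fD x (- x); rewrite subrr f0; lra.
have fZ_le t e : f (- e) <= - f e -> f (- (t *: e)) <= - f (t *: e).
  move=> fe; have [t0|t0] := leP 0 t.
    by rewrite -scalerN !(sublinearZ _ fs t0) -mulrN ler_wpM2l.
  have nt0 : 0 <= - t by lra.
  rewrite -scaleNr (sublinearZ _ fs nt0) -[t *: e]opprK -scaleNr -scalerN.
  by rewrite (sublinearZ _ fs nt0) -mulrN ler_wpM2l// lerNr.
(* The vectors [y] with [f (- y) <= - f y] are closed under sums and, by [fZ_le], under scaling, so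
   the property spreads from the basis to the whole space. *)
have flinT x : f (- x) = - f x.
  apply/eqP; rewrite eq_le fN_ge andbT.
  rewrite (coord_vbasis (memvf x)); apply: (big_ind (fun y => f (- y) <= - f y)).
  - by rewrite oppr0 f0 oppr0.
  - move=> y z fy fz; rewrite opprD.
    by have := fD (- y) (- z); have := fD y z; lra.
  - move=> i _; apply/fZ_le/flin.
    by rewrite mem_nth// size_tuple.
exists f; split.
- move=> x y; apply/eqP; rewrite eq_le fD /=.
  by have := fD (x + y) (- y); rewrite addrK flinT; lra.
- move=> t x; have [t0|t0] := leP 0 t; first by rewrite (sublinearZ _ fs t0).
  have nt0 : 0 <= - t by rewrite oppr_ge0 ltW.
  rewrite -[t *: x]opprK -scaleNr flinT (sublinearZ _ fs nt0).
  by rewrite mulNr opprK.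
- by move=> x; exact: le_trans (fq _) (qp _).
- move=> k c Gkc; have := qG _ _ Gkc; have := fq (- k); rewrite flinT; lra.
Qed.

End SublinearExtension.

(** * The entrywise norms, their duality and the subdifferential *)

Section EntrywiseNorms.
Variable R : realType.

Lemma mx_norm1_ge0 m n (A : 'M[R]_(m, n)) : 0 <= mx_norm1 A.
Proof. by apply: sumr_ge0 => i _; apply: sumr_ge0 => j _. Qed.

Lemma mx_norm1D m n (A B : 'M[R]_(m, n)) :
  mx_norm1 (A + B) <= mx_norm1 A + mx_norm1 B.
Proof.
rewrite /mx_norm1 -big_split; apply: ler_sum => i _ /=.
rewrite -big_split; apply: ler_sum => j _ /=.
by rewrite mxE ler_normD.
Qed.

Lemma mx_norm1Z m n a (A : 'M[R]_(m, n)) : mx_norm1 (a *: A) = `|a| * mx_norm1 A.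
Proof.
rewrite /mx_norm1 mulr_sumr; apply: eq_bigr => i _; rewrite mulr_sumr.
by apply: eq_bigr => j _; rewrite mxE normrM.
Qed.

Lemma mx_norm1_0 m n : mx_norm1 (0 : 'M[R]_(m, n)) = 0.
Proof. by rewrite -(scale0r 0) mx_norm1Z normr0 mul0r. Qed.

Lemma mx_norm1_delta m n i j : mx_norm1 (delta_mx i j : 'M[R]_(m, n)) = 1.
Proof.
rewrite /mx_norm1 (bigD1 i)//= (bigD1 j)//= mxE !eqxx normr1.
rewrite big1 => [|j' nj]; last by rewrite mxE eqxx (negbTE nj) normr0.
rewrite big1 ?addr0// => i' ni; rewrite big1// => j' _.
by rewrite mxE (negbTE ni) normr0.
Qed.

Lemma mxdot_delta m n (A : 'M[R]_(m, n)) i j : mxdot A (delta_mx i j) = A i j.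
Proof.
rewrite mxdotE (bigD1 j)//= (bigD1 i)//= mxE !eqxx mulr1.
rewrite big1 => [|i' ni]; last by rewrite mxE (negbTE ni) mulr0.
rewrite big1 ?addr0// => j' nj; rewrite big1// => i' _.
by rewrite mxE (negbTE nj) andbF mulr0.
Qed.

Lemma mx_entry_le m n (A : 'M[R]_(m, n)) i j : `|A i j| <= mx_norm A.
Proof. by rewrite mx_normrE; apply/bigmax_geP; right; exists (i, j). Qed.

Lemma mxdot_norm1_le m n (A B : 'M[R]_(m, n)) : mxdot A B <= mx_norm1 A * mx_norm B.
Proof.
rewrite mxdotE exchange_big /mx_norm1 mulr_suml; apply: ler_sum => i _.
rewrite mulr_suml; apply: ler_sum => j _; apply: le_trans (ler_norm _) _.
by rewrite normrM ler_wpM2l ?mx_entry_le.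
Qed.

(** Testing against plus and minus a matrix unit bounds each entry. *)
Lemma mx_norm_le m n (A : 'M[R]_(m, n)) c : 0 <= c ->
  (forall B, mxdot A B <= c * mx_norm1 B) -> mx_norm A <= c.
Proof.
move=> c0 Ac; rewrite mx_normrE; apply/bigmax_leP; split => // -[i j] _ /=.
have := Ac (-1 *: delta_mx i j); have := Ac (delta_mx i j).
rewrite mxdotZr !mxdot_delta mx_norm1Z normrN1 mul1r mx_norm1_delta mulr1 mulN1r.
by move=> Aij nAij; rewrite ler_norml lerNl nAij.
Qed.

Lemma linear_mxdot m n (f : 'M[R]_(m, n) -> R) :
  (forall A B, f (A + B) = f A + f B) -> (forall t A, f (t *: A) = t * f A) ->
  forall A, mxdot A (\matrix_(i, j) f (delta_mx i j)) = f A.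
Proof.
move=> fD fZ A; have f0 : f 0 = 0 by rewrite -(scale0r 0) fZ mul0r.
rewrite mxdotE exchange_big {2}[A]matrix_sum_delta (big_morph f fD f0).
apply: eq_bigr => i _; rewrite (big_morph f fD f0).
by apply: eq_bigr => j _; rewrite fZ mxE.
Qed.

(** By homogeneity, the subgradient inequality at [0] and at [2 *: W] forces
    [mxdot G W = mx_norm1 W]; what remains of it is the dual norm bound. *)
Lemma subdifferential_norm1P m n (W G : 'M[R]_(m, n)) :
  subdifferential (@mx_norm1 R m n) W G <->
  mxdot G W = mx_norm1 W /\ forall B, mxdot G B <= mx_norm1 B.
Proof.
split => [GW|[GW G1] B]; last by rewrite mxdotDr mxdotNr GW; have := G1 B; lra.
have GWE : mxdot G W = mx_norm1 W.
  have := GW 0; rewrite mxdotDr mxdotNr mxdot0r mx_norm1_0.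
  have := GW (2 *: W); rewrite mxdotDr mxdotNr mxdotZr mx_norm1Z ger0_norm//.
  lra.
by split => // B; have := GW B; rewrite mxdotDr mxdotNr GWE; lra.
Qed.

End EntrywiseNorms.

(** * A dual certificate for an optimal pair of (P) *)

Section StrongDuality.
Variable R : realType.

Lemma sublinear_nuclear_norm1 m n (gamma : R) : 0 <= gamma ->
  sublinear (fun A : 'M[R]_(m, n) * 'M[R]_(m, n) =>
    nuclear_norm A.1 + gamma * mx_norm1 A.2).
Proof.
move=> g0; split => [A B|t A t0] /=.
  rewrite addrACA lerD ?nuclear_normD// -mulrDr ler_wpM2l//.
  exact: mx_norm1D.
by rewrite mulrDr mulrCA lerD ?nuclear_normZ// mx_norm1Z ger0_norm.
Qed.

(* G prescribes the value t * c, with c the optimal value, on the pairs whose sum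
   is t *: M; a linear F above G kills every (A, - A), hence depends on the sum
   of its arguments only, and W represents it. *)
Lemma optimal_P_certificate m n (M : 'M[R]_(m, n)) gamma X Y : 0 < gamma ->
  optimal_P M gamma (X, Y) ->
  exists W : 'M[R]_(m, n), [/\ spectral_norm W <= 1, mx_norm W <= gamma
    & nuclear_norm X + gamma * mx_norm1 Y <= mxdot M W].
Proof.
move=> g_gt0 [XY opt]; have g_ge0 := ltW g_gt0.
pose q (A : 'M[R]_(m, n) * 'M[R]_(m, n)) := nuclear_norm A.1 + gamma * mx_norm1 A.2.
have {}opt A : A.1 + A.2 = M -> q (X, Y) <= q A by exact: opt.
have qs : sublinear q by exact: sublinear_nuclear_norm1.
have q_ge0 A : 0 <= q A.
  by rewrite addr_ge0 ?nuclear_norm_ge0 ?mulr_ge0 ?mx_norm1_ge0.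
pose G (A : 'M[R]_(m, n) * 'M[R]_(m, n)) a :=
  exists2 t : R, A.1 + A.2 = t *: M & a = t * q (X, Y).
have Gq : cone_below q G.
  split.
  - by exists 0; rewrite ?mul0r //= addr0 scale0r.
  - move=> A a B b [t At ->] [u Bu ->]; exists (t + u); last by rewrite mulrDl.
    by rewrite /= addrACA At Bu scalerDl.
  - move=> t A a t0 [u Au ->]; exists (t * u); last by rewrite mulrA.
    by rewrite /= -scalerDr Au scalerA.
  (* For [t <= 0] the prescribed value is at most 0; for [t > 0], dividing by [t] gives a feasible
     pair, to which optimality applies. *)
  - move=> A _ [t At ->]; have [t_le0|t_gt0] := leP t 0.
      by apply: le_trans (q_ge0 _); rewrite mulr_le0_ge0.
    rewrite -ler_pdivlMl//; have /opt : (t^-1 *: A).1 + (t^-1 *: A).2 = M.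
      by rewrite /= -scalerDr At scalerA mulVf ?scale1r ?gt_eqF.
    by rewrite sublinearZ// invr_ge0 ltW.
have [F [FD FZ Fq FG]] := linear_sandwich qs Gq.
have F0 : F 0 = 0 by rewrite -(scale0r 0) FZ mul0r.
have anti A : F (A, - A) = 0.
  have F_ge0 B : 0 <= F (B, - B).
    by apply: FG; exists 0; rewrite ?mul0r //= subrr scale0r.
  have := F_ge0 A; have := F_ge0 (- A).
  have := FD (A, - A) (- A, - - A).
  have -> : (A, - A) + (- A, - - A) = 0 by congr pair; rewrite subrr.
  by rewrite F0; lra.
have F2 A : F (0, A) = F (A, 0).
  have := FD (A, - A) (0, A).
  have -> : (A, - A) + (0, A) = (A, 0) by congr pair; rewrite ?addr0 ?addNr.
  by rewrite anti add0r.
pose W : 'M[R]_(m, n) := \matrix_(i, j) F (delta_mx i j, 0).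
have WE A : mxdot A W = F (A, 0).
  apply: (linear_mxdot (f := fun A => F (A, 0))) => [B C|t B].
    by rewrite -FD; congr (F (_, _)); rewrite addr0.
  by rewrite -FZ; congr (F (_, _)); rewrite scaler0.
exists W; split.
- apply: spectral_norm_le1 => A; rewrite WE; apply: le_trans (Fq _) _.
  by rewrite /q mx_norm1_0 mulr0 addr0.
- apply: mx_norm_le => // B; rewrite mxdotC WE -F2; apply: le_trans (Fq _) _.
  by rewrite /q nuclear_norm0 add0r.
- by rewrite WE; apply: FG; exists 1; rewrite ?mul1r //= addr0 scale1r.
Qed.

End StrongDuality.

(** * What a singular value decomposition says about its leading vectors *)

Section LeadingSingularVectors.
Variable R : realType.

Lemma svd_gram m n (Z : 'M[R]_(m, n)) P s Q : is_svd Z P s Q ->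
  Z^T *m Z = Q *m diag_mx (\row_i (s 0 i * s 0 i)) *m Q^T.
Proof.
move=> [PP QQ s_ge0 s_mono ->]; rewrite !trmx_mul trmxK tr_diag_mx.
rewrite !mulmxA -(mulmxA _ P^T P) PP mulmx1.
by rewrite -(mulmxA Q (diag_mx s) (diag_mx s)) mulmx_diag.
Qed.

Lemma widen_ord_inj j k (le_jk : (j <= k)%N) : injective (widen_ord le_jk).
Proof. by move=> i i' /(congr1 val) /= /val_inj. Qed.

(** If [i] is in [A] then so are all [i.+1] indices up to [i], hence [i < #|A|]. So [A] lies in an
    initial segment of its own size and equals it. *)
Lemma downset_card k (A : {pred 'I_k}) :
  (forall i j : 'I_k, (j <= i)%N -> i \in A -> j \in A) ->
  forall i, (i \in A) = (i < #|A|)%N.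
Proof.
move=> Adown.
have cardlt j : (j <= k)%N -> #|[pred i : 'I_k | (i < j)%N]| = j.
  move=> jk; rewrite -[RHS]card_ord -(card_codom (@widen_ord_inj _ _ jk)).
  apply: eq_card => i; rewrite inE; apply/idP/codomP => [ij|[i' ->]] //=.
  by exists (Ordinal ij); exact: val_inj.
have Asub : A \subset [pred i : 'I_k | (i < #|A|)%N].
  apply/fintype.subsetP => i iA; rewrite inE -{1}(cardlt i.+1 (ltn_ord i)).
  apply: subset_leq_card; apply/fintype.subsetP => j; rewrite inE ltnS => ji.
  exact: Adown ji iA.
have AE : A =i [pred i : 'I_k | (i < #|A|)%N].
  apply/subset_cardP => //; rewrite cardlt//.
  by rewrite -[leqRHS]card_ord max_card.
by move=> i; rewrite AE inE.
Qed.

(** The entries of [s] are nonincreasing and at most the spectral norm, so those reaching it form an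
    initial segment, whose length is the multiplicity. *)
Lemma svd_leadingE m n (Z : 'M[R]_(m, n)) P s Q : is_svd Z P s Q ->
  0 < spectral_norm Z -> forall i,
  (s 0 i == spectral_norm Z) = (i < singular_mult Z (spectral_norm Z))%N.
Proof.
move=> svd Z_gt0 i; have gram := svd_gram svd.
have [PP QQ s_ge0 s_mono _] := svd.
have sE j : ((\row_i (s 0 i * s 0 i)) 0 j == spectral_norm Z ^+ 2) =
    (s 0 j == spectral_norm Z).
  by rewrite mxE -expr2 eqrXn2// ltW.
have s_le j : s 0 j <= spectral_norm Z.
  rewrite -(@ler_pXn2r _ 2) ?nnegrE ?s_ge0 ?spectral_norm_ge0//.
  by have := gram_diag_le QQ gram j; rewrite mxE -expr2.
rewrite (singular_multE QQ gram (lt0r_neq0 Z_gt0)).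
rewrite (eq_card (B := [pred j | s 0 j == spectral_norm Z])) => [|j]; last first.
  by rewrite !inE -sE.
rewrite -[LHS]/(i \in [pred j | s 0 j == spectral_norm Z]).
apply: downset_card => i' j le_ji; rewrite !inE => /eqP si.
by rewrite eq_le s_le -si s_mono.
Qed.

(** The last clause says that [V] spans the whole top eigenspace of [Z^T *m Z]: since [r] is the
    full multiplicity, an eigenvector there has no coordinates beyond the first [r]. *)
Lemma leading_singular_vectorsP m n (Z : 'M[R]_(m, n)) r
    (U : 'M[R]_(m, r)) (V : 'M[R]_(n, r)) :
  0 < spectral_norm Z -> r = singular_mult Z (spectral_norm Z) ->
  leading_singular_vectors Z U V ->
  [/\ U^T *m U = 1%:M, V^T *m V = 1%:M, Z *m V = spectral_norm Z *: U
    & forall b : 'cV[R]_n, Z^T *m Z *m b = spectral_norm Z ^+ 2 *: b ->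
        V *m V^T *m b = b].
Proof.
move=> Z_gt0 rE [P [s [Q [svd [le_r [-> ->]]]]]].
have leadE := svd_leadingE svd Z_gt0; have gram := svd_gram svd.
have [PP QQ s_ge0 s_mono ZE] := svd.
set w := widen_ord le_r.
have orth p (B : 'M[R]_(p, _)) : B^T *m B = 1%:M ->
    (colsub w B)^T *m colsub w B = 1%:M.
  move=> BB; apply/matrixP => i j; have /matrixP/(_ (w i) (w j)) := BB.
  rewrite !mxE (inj_eq (@widen_ord_inj _ _ le_r)) => <-.
  by apply: eq_bigr => l _; rewrite !mxE.
have s_lead i : s 0 (w i) = spectral_norm Z.
  by apply/eqP; rewrite leadE -rE /= ltn_ord.
split; [exact: orth|exact: orth| |].
  rewrite mulmx_colsub {1}ZE -mulmxA QQ mulmx1.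
  by apply/matrixP => i j; rewrite mxE mul_mx_diag !mxE s_lead mulrC.
move=> b Zb; have b0 : spectral_norm Z ^+ 2 != 0 by rewrite expf_neq0// gt_eqF.
set y := Q^T *m b.
have yE i : s 0 i ^+ 2 * y i 0 = spectral_norm Z ^+ 2 * y i 0.
  have : Q^T *m (Z^T *m Z *m b) = diag_mx (\row_i (s 0 i * s 0 i)) *m y.
    by rewrite gram !mulmxA QQ mul1mx.
  rewrite Zb -scalemxAr => /colP/(_ i).
  by rewrite mul_diag_mx !mxE -expr2 => ->.
have y0 (i : 'I_(minn m n)) : (r <= i)%N -> y i 0 = 0.
  move=> ri; apply/eqP; apply: contraTT ri => yi0; rewrite -ltnNge rE -leadE.
  by rewrite -(@eqrXn2 _ 2) ?s_ge0 ?spectral_norm_ge0//; apply/eqP/(mulIf yi0).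
(* [Q] need not be square; [b] is in its column space as a multiple of [Z^T *m Z *m b]. *)
have bE : b = Q *m y.
  apply: (scalerI b0); rewrite -Zb gram -!mulmxA -/y scalemxAr.
  by congr (Q *m _); apply/colP => i; rewrite mul_diag_mx mxE [X in X * _]mxE -expr2 yE [RHS]mxE.
have VV : (colsub w Q)^T *m b = rowsub w y.
  by apply/colP => i; rewrite !mxE; apply: eq_bigr => l _; rewrite !mxE.
rewrite -mulmxA VV bE; apply/colP => i; rewrite !mxE.
rewrite [RHS](bigID (fun j : 'I_(minn m n) => (j < r)%N)) /= [X in _ + X]big1 ?addr0.
  rewrite (big_ord_narrow le_r) /=.
  by apply: eq_bigr => j _; rewrite !mxE.
by move=> j; rewrite -leqNgt => rj; rewrite y0// mulr0.
Qed.

End LeadingSingularVectors.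

(** * Complementarity and sufficiency for optimal pairs *)

Section Optimality.
Variable R : realType.

Lemma spectral_normZ_le m n a (W : 'M[R]_(m, n)) : 0 <= a ->
  spectral_norm (a *: W) <= a * spectral_norm W.
Proof.
move=> a0; apply: spectral_norm_le => [|v]; first by rewrite mulr_ge0 ?spectral_norm_ge0.
rewrite -scalemxAl mxdotZl mxdotZr mulrA -expr2 exprMn -[leRHS]mulrA.
by rewrite ler_wpM2l ?sqr_ge0 ?mxdot_mul_le.
Qed.

Lemma mx_normZ_ge0 m n a (W : 'M[R]_(m, n)) : 0 <= a ->
  mx_norm (a *: W) = a * mx_norm W.
Proof. by move=> a0; rewrite -[LHS]/`|a *: W| mx_normZ ger0_norm. Qed.

Lemma spectral_norm_gt0 m n (Z : 'M[R]_(m, n)) : Z != 0 -> 0 < spectral_norm Z.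
Proof.
move=> Z0; rewrite lt_neqAle spectral_norm_ge0 andbT eq_sym.
apply: contra_neq Z0 => nZ0; apply: mxdot_eq0; apply/eqP.
rewrite eq_le mxdot_ge0 andbT.
by have := mxdot_nuclear_spectral_le Z Z; rewrite nZ0 mulr0.
Qed.

Variables (m n : nat) (M Z : 'M[R]_(m, n)) (gamma : R).
Hypothesis gamma_gt0 : 0 < gamma.

(* Tightness of <M, Z> = <X, Z> + <M - X, Z> <= s (||X||_* + gamma ||M - X||_1). *)
Lemma optimal_P_complementarity (X : 'M[R]_(m, n)) : optimal_D M gamma Z -> X != 0 ->
  optimal_P M gamma (X, M - X) ->
  [/\ mxdot X Z = nuclear_norm X * spectral_norm Z,
      mxdot (M - X) Z = gamma * spectral_norm Z * mx_norm1 (M - X)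
    & mx_norm Z <= gamma * spectral_norm Z].
Proof.
move=> [/= MZ Zmin] X0 optX.
have [W [W1 Wg MW]] := optimal_P_certificate gamma_gt0 optX.
set Y := M - X in MW *; set a := nuclear_norm X in MW *.
set b := mx_norm1 Y in MW *; set s := spectral_norm Z.
set D := Num.max _ _ in Zmin.
have a_gt0 : 0 < a by exact: nuclear_norm_gt0.
have b_ge0 : 0 <= b by exact: mx_norm1_ge0.
have c_gt0 : 0 < a + gamma * b by rewrite ltr_wpDr// mulr_ge0// ltW.
set c := a + gamma * b in MW c_gt0.
have c'_ge0 : 0 <= c^-1 by rewrite invr_ge0 ltW.
(* The certificate scaled by [c^-1] is feasible for (D), with value at most [c^-1]. *)
have Dc : D <= c^-1.
  apply: le_trans (Zmin (c^-1 *: W) _) _.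
    by rewrite /= mxdotZr mulrC ler_pdivlMr// mul1r.
  rewrite ge_max; apply/andP; split.
    apply: le_trans (spectral_normZ_le _ c'_ge0) _.
    by rewrite -[leRHS]mulr1 ler_wpM2l.
  by rewrite ler_pdivrMr// mx_normZ_ge0// ler_wpM2l.
have sD : s <= D by rewrite le_max lexx.
have ZD : mx_norm Z <= gamma * D.
  by rewrite mulrC -ler_pdivrMr// le_max lexx orbT.
have Dc1 : D * c <= 1 by rewrite -ler_pdivlMr// mul1r.
have XZ : mxdot X Z <= a * s by exact: mxdot_nuclear_spectral_le.
have YZ : mxdot Y Z <= b * (gamma * D).
  by apply: le_trans (mxdot_norm1_le _ _) _; rewrite ler_wpM2l.
have XYZ : mxdot M Z = mxdot X Z + mxdot Y Z.
  by rewrite -mxdotDl /Y addrC subrK.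
have asD : a * s <= a * D by rewrite ler_pM2l.
have DcE : D * c = a * D + b * (gamma * D) by rewrite /c; ring.
(* The chain [1 <= <M,Z> <= a s + b gamma D <= D c <= 1] collapses. As [a > 0], this identifies [s]
   with [D]. *)
have aDs : a * D <= a * s by lra.
have sDE : s = D by apply/eqP; rewrite eq_le sD -(ler_pM2l a_gt0).
by rewrite -sDE in ZD YZ DcE Dc1; split => //; lra.
Qed.

(** Weak duality: [s] times the objective is at least [<M,Z>] at every feasible pair, with equality
    at [(X, M - X)]. *)
Lemma optimal_P_sufficient (X : 'M[R]_(m, n)) (s : R) : 0 < s -> spectral_norm Z = s ->
  mx_norm Z <= gamma * s -> mxdot X Z = s * nuclear_norm X ->
  mxdot (M - X) Z = gamma * s * mx_norm1 (M - X) ->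
  optimal_P M gamma (X, M - X).
Proof.
move=> s_gt0 Zs Zg XZ YZ; split => [|[X' Y'] /= XY']; first by rewrite /= addrC subrK.
rewrite -(ler_pM2l s_gt0).
have -> : s * (nuclear_norm X + gamma * mx_norm1 (M - X)) = mxdot X' Z + mxdot Y' Z.
  by rewrite -mxdotDl XY' mulrDr -XZ mulrA (mulrC s) -YZ -mxdotDl addrC subrK.
rewrite mulrDr lerD//.
  by rewrite mulrC -Zs mxdot_nuclear_spectral_le.
apply: le_trans (mxdot_norm1_le _ _) _.
have -> : s * (gamma * mx_norm1 Y') = mx_norm1 Y' * (gamma * s) by ring.
by rewrite ler_wpM2l ?mx_norm1_ge0.
Qed.

End Optimality.

Theorem theorem3p5 (R : realType) (m n : nat) (M : 'M[R]_(m, n)) (gamma : R)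
    (M_neq0 : M != 0) (gamma_gt0 : 0 < gamma)
    (notopt_M0 : ~ optimal_P M gamma (M, 0))
    (notopt_0M : ~ optimal_P M gamma (0, M))
    (Z : 'M[R]_(m, n)) (optZ : optimal_D M gamma Z)
    (r : nat) (r_mult : r = singular_mult Z (spectral_norm Z))
    (U : 'M[R]_(m, r)) (V : 'M[R]_(n, r))
    (UV_leading : leading_singular_vectors Z U V)
    (X : 'M[R]_(m, n)) :
  [/\ optimal_P M gamma (X, M - X), X != 0 & M - X != 0] <->
  (exists2 T : 'M[R]_r, psdmx T & X = U *m T *m V^T) /\
  subdifferential (@mx_norm1 R m n) (M - X)
    ((gamma * spectral_norm Z)^-1 *: Z).
Proof.
have Z0 : Z != 0.
  apply/eqP => Z0; have [/= + _] := optZ.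
  by rewrite Z0 mxdot0r ler10.
have s_gt0 := spectral_norm_gt0 Z0.
have gs_gt0 : 0 < gamma * spectral_norm Z by rewrite mulr_gt0.
have gs_neq0 := lt0r_neq0 gs_gt0.
have [UU VV ZV leadV] := leading_singular_vectorsP s_gt0 r_mult UV_leading.
split.
  move=> [optX X0 Y0].
  have [XZ YZ Zg] := optimal_P_complementarity gamma_gt0 optZ X0 optX.
  split; first exact: nuclear_spectral_eq ZV leadV XZ.
  apply/subdifferential_norm1P; split => [|B].
    by rewrite mxdotZl mxdotC YZ mulKf.
  rewrite mxdotZl ler_pdivrMl// mxdotC; apply: le_trans (mxdot_norm1_le _ _) _.
  by rewrite mulrC ler_wpM2r ?mx_norm1_ge0.
move=> [[T Tpsd XE] /subdifferential_norm1P[GY G1]].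
(* A subgradient of the entrywise 1-norm has entries of absolute value at most 1. *)
have Zg : mx_norm Z <= gamma * spectral_norm Z.
  apply: mx_norm_le => [|B]; first exact: ltW.
  by rewrite -ler_pdivrMl// -mxdotZl.
have YZ : mxdot (M - X) Z = gamma * spectral_norm Z * mx_norm1 (M - X).
  by rewrite -GY mxdotZl mulVKf// mxdotC.
(* Both sides equal [spectral_norm Z * \tr T]. *)
have XZ : mxdot X Z = spectral_norm Z * nuclear_norm X.
  rewrite XE nuclear_norm_psd// mxdot_mulAr trmxK ZV mxdotZr; congr (_ * _).
  by rewrite mxdot_mulAl UU /mxdot mulmx1 mxtrace_tr.
have optX := optimal_P_sufficient s_gt0 erefl Zg XZ YZ.
(* If [X] or [M - X] vanished, the optimal pair would be [(0, M)] or [(M, 0)], both excluded by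
   assumption. *)
split => //; apply/eqP.
  by move=> X0; apply: notopt_0M; move: optX; rewrite X0 subr0.
by move=> Y0; apply: notopt_M0; move: optX; rewrite Y0 -(subr0_eq Y0).
Qed.
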